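(* Let $\mathbb{K}$ be an algebraically closed field of characteristic zero and let $(A,H,\triangleleft,\triangleright)$ be a matched pair of Hopf algebras over $\mathbb{K}$. Assume that $A$ and $H$ are almost involutive with companion automorphisms $\sigma_A$ and $\sigma_H$ respectively, and that for all $x\in H$ and $a\in A$: (a) $\sigma_A(x\triangleright a)=\sigma_H(x)\triangleright\sigma_A(a)$; (b) $\sigma_H(x\triangleleft a)=\sigma_H(x)\triangleleft\sigma_A(a)$. Then the bicrossed product $A\bowtie H$ is almost involutive.
   Context: A Hopf algebra $L$ with antipode $\mathcal{S}$ is almost involutive if there exists a Hopf algebra automorphism $\sigma:L\to L$ with $\sigma^2=\mathcal{S}^2$; such a $\sigma$ is called a companion automorphism of $L$. A matched pair of Hopf algebras $(A,H,\triangleleft,\triangleright)$ consists of Hopf algebras $A,H$ and linear maps $\triangleright:H\otimes A\to A$ and $\triangleleft:H\otimes A\to H$ such that $A$ is a left $H$-module coalgebra via $\triangleright$, $H$ is a right $A$-module coalgebra via $\triangleleft$, and for all $x,y\in H$, $a,b\in A$ (Sweedler notation): $x\triangleright(ab)=\sum(x_1\triangleright a_1)\big((x_2\triangleleft a_2)\triangleright b\big)$; $x\triangleright 1=\varepsilon(x)1$; $(xy)\triangleleft a=\sum\big(x\triangleleft(y_1\triangleright a_1)\big)(y_2\triangleleft a_2)$; $1\triangleleft a=\varepsilon(a)1$; $\sum (x_1\triangleleft a_1)\otimes(x_2\triangleright a_2)=\sum(x_2\triangleleft a_2)\otimes(x_1\triangleright a_1)$. The bicrossed product $A\bowtie H$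 is the Hopf algebra with underlying coalgebra the tensor product coalgebra $A\otimes H$ and with product $(a\otimes x)(b\otimes y)=\sum a(x_1\triangleright b_1)\otimes(x_2\triangleleft b_2)y$ and unit $1\otimes 1$; writing $ax$ for $a\otimes x$, its antipode is $\mathcal{S}(ax)=\mathcal{S}_H(x)\mathcal{S}_A(a)$. *)

(* Defs.v *)
From HB Require Import structures.
From mathcomp Require Import all_boot all_order all_algebra generic_quotient.
From mathcomp Require Import boolp.

Set Implicit Arguments.
Unset Strict Implicit.
Unset Printing Implicit Defensive.

Import GRing.Theory.
Local Open Scope ring_scope.
Local Open Scope quotient_scope.

(* V ⊗ W is the module of formal finite sums of pairs (v, w), i.e. of lists
   over V * W, modulo the congruence generated by commutativity and
   bilinearity; scalars act on the first component. *)

Inductive tens_eq (K : fieldType) (V W : lmodType K) :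
    seq (V * W) -> seq (V * W) -> Prop :=
| tens_refl s : tens_eq s s
| tens_sym s t : tens_eq s t -> tens_eq t s
| tens_trans s t u : tens_eq s t -> tens_eq t u -> tens_eq s u
| tens_cat s s' t t' : tens_eq s s' -> tens_eq t t' ->
    tens_eq (s ++ t) (s' ++ t')
| tens_catC s t : tens_eq (s ++ t) (t ++ s)
| tens_addl v v' w : tens_eq [:: (v + v', w)] [:: (v, w); (v', w)]
| tens_addr v w w' : tens_eq [:: (v, w + w')] [:: (v, w); (v, w')]
| tens_scale c v w : tens_eq [:: (c *: v, w)] [:: (v, c *: w)]
| tens_zero w : tens_eq [:: (0, w)] [::].

Section TensorProduct.
Context (K : fieldType) (V W : lmodType K).
Implicit Types (s t : seq (V * W)) (c : K).

Definition tens_eqb s t : bool := `[< tens_eq s t >].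

Lemma tens_eqb_refl : reflexive tens_eqb.
Proof. by move=> s; apply/asboolP; exact: tens_refl. Qed.

Lemma tens_eqb_sym : symmetric tens_eqb.
Proof. by move=> s t; apply/asboolP/asboolP; exact: tens_sym. Qed.

Lemma tens_eqb_trans : transitive tens_eqb.
Proof.
by move=> t s u /asboolP st /asboolP tu; apply/asboolP; exact: tens_trans tu.
Qed.

Canonical tens_equiv := EquivRel tens_eqb tens_eqb_refl tens_eqb_sym
  tens_eqb_trans.

Definition tensor := {eq_quot tens_equiv}.

HB.instance Definition _ := Choice.on tensor.
HB.instance Definition _ := EqQuotient.on tensor.

Implicit Types u : tensor.

Local Notation cls s := (\pi_tensor s).

Lemma tens_piP s t : cls s = cls t <-> tens_eq s t.
Proof.
split=> [/eqquotP/asboolP//|st]; by apply/eqquotP/asboolP.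
Qed.

Lemma tens_reprP s : tens_eq (repr (cls s)) s.
Proof. by apply/tens_piP; rewrite reprK. Qed.

Definition tens0 : tensor := cls [::].
Definition tens_add u1 u2 : tensor := cls (repr u1 ++ repr u2).
Definition tens_scl c u : tensor :=
  cls [seq (c *: p.1, p.2) | p <- repr u].

Lemma tens_add_pi s t : tens_add (cls s) (cls t) = cls (s ++ t).
Proof. by apply/tens_piP; apply: tens_cat; exact: tens_reprP. Qed.

Lemma tens_eq_scl c s t : tens_eq s t ->
  tens_eq [seq (c *: p.1, p.2) | p <- s] [seq (c *: p.1, p.2) | p <- t].
Proof.
elim=> {s t}.
- by move=> s; exact: tens_refl.
- by move=> s t _; exact: tens_sym.
- by move=> s t u _ st _ tu; exact: tens_trans tu.
- by move=> s s' t t' _ ss _ tt; rewrite !map_cat; exact: tens_cat.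
- by move=> s t; rewrite !map_cat; exact: tens_catC.
- by move=> v v' w /=; rewrite scalerDr; exact: tens_addl.
- by move=> v w w' /=; exact: tens_addr.
- move=> d v w /=; rewrite scalerA mulrC -scalerA; exact: tens_scale.
- by move=> w /=; rewrite scaler0; exact: tens_zero.
Qed.

Lemma tens_scl_pi c s :
  tens_scl c (cls s) = cls [seq (c *: p.1, p.2) | p <- s].
Proof. by apply/tens_piP; apply: tens_eq_scl; exact: tens_reprP. Qed.

Lemma tens_piW (P : tensor -> Prop) : (forall s, P (cls s)) -> forall u, P u.
Proof. by move=> Ps u; rewrite -[u]reprK; exact: Ps. Qed.

Lemma tens_addA : associative tens_add.
Proof.
elim/tens_piW=> x; elim/tens_piW=> y; elim/tens_piW=> z.
by rewrite !tens_add_pi catA.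
Qed.

Lemma tens_addC : commutative tens_add.
Proof.
elim/tens_piW=> x; elim/tens_piW=> y; rewrite !tens_add_pi.
by apply/tens_piP; exact: tens_catC.
Qed.

Lemma tens_add0 : left_id tens0 tens_add.
Proof. by elim/tens_piW=> s; rewrite tens_add_pi. Qed.

Lemma tens_sclDl u : {morph tens_scl^~ u : a b / a + b >-> tens_add a b}.
Proof.
move=> a b; elim/tens_piW: u => s.
rewrite !tens_scl_pi tens_add_pi; apply/tens_piP; elim: s => [|[v w] s IH] /=; first exact: tens_refl.
move: IH; set C := map _ s; set A := map _ s; set B := map _ s => IH.
rewrite scalerDl.
set x := (a *: v, w); set y := (b *: v, w).
apply: (@tens_trans _ _ _ _ ([:: x; y] ++ (A ++ B))).
  by rewrite -cat1s; apply: tens_cat IH; exact: tens_addl.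
have -> : [:: x; y] ++ A ++ B = [:: x] ++ ([:: y] ++ A) ++ B by rewrite -!catA.
have -> : x :: A ++ y :: B = [:: x] ++ (A ++ [:: y]) ++ B by rewrite -!catA.
apply: tens_cat; first exact: tens_refl.
by apply: tens_cat; [exact: tens_catC | exact: tens_refl].
Qed.

Lemma tens_scl0 u : tens_scl 0 u = tens0.
Proof.
elim/tens_piW: u => s; rewrite tens_scl_pi; apply/tens_piP.
elim: s => [|[v w] s IH] /=; first exact: tens_refl.
rewrite scale0r -cat1s -[[::]]cat0s.
by apply: tens_cat IH; exact: tens_zero.
Qed.

Lemma tens_scl1 : left_id 1 tens_scl.
Proof.
elim/tens_piW=> s; rewrite tens_scl_pi; congr (cls _).
by rewrite -[RHS]map_id; apply: eq_map => -[v w] /=; rewrite scale1r.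
Qed.

Lemma tens_sclA a b u : tens_scl a (tens_scl b u) = tens_scl (a * b) u.
Proof.
elim/tens_piW: u => s; rewrite !tens_scl_pi -map_comp; congr (cls _).
by apply: eq_map => -[v w] /=; rewrite scalerA.
Qed.

Lemma tens_sclDr c : {morph tens_scl c : x y / tens_add x y}.
Proof.
elim/tens_piW=> x; elim/tens_piW=> y; rewrite !(tens_scl_pi, tens_add_pi).
by rewrite map_cat.
Qed.

Lemma tens_addN : left_inverse tens0 (tens_scl (- 1)) tens_add.
Proof.
move=> u; rewrite -{2}[u]tens_scl1 -tens_sclDl addNr; exact: tens_scl0.
Qed.

HB.instance Definition _ := GRing.isZmodule.Build tensor
  tens_addA tens_addC tens_add0 tens_addN.

HB.instance Definition _ := GRing.Zmodule_isLmodule.Build K tensor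
  tens_sclA tens_scl1 tens_sclDr tens_sclDl.

Lemma tens_addE s t : cls s + cls t = cls (s ++ t).
Proof. exact: tens_add_pi. Qed.

Lemma tens_scaleE c s : c *: cls s = cls [seq (c *: p.1, p.2) | p <- s].
Proof. exact: tens_scl_pi. Qed.

Definition tens (v : V) (w : W) : tensor := cls [:: (v, w)].

End TensorProduct.

Notation "V ⊗ W" := (tensor V W)
  (at level 40, left associativity) : type_scope.
Notation "v ⊗ w" := (tens v w)
  (at level 40, left associativity) : ring_scope.

(* Sweedler notation: if t = \sum_i v_i ⊗ w_i then
   \tsum_(v, w <- t) f v w = \sum_i f v_i w_i.  The decomposition used is the
   chosen representative of t; for bilinear f the value does not depend on it,
   see lemma tsum_tens below. *)
Definition tsum (K : fieldType) (V W : lmodType K) (U : nmodType)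
    (t : V ⊗ W) (f : V -> W -> U) : U :=
  \sum_(p <- repr t) f p.1 p.2.

Notation "\tsum_ ( v , w <- t ) E" := (tsum t (fun v w => E))
  (at level 41, E at level 41, v name, w name,
   format "'[' \tsum_ ( v ,  w  <-  t ) '/  '  E ']'") : ring_scope.

Section TensorTheory.
Context (K : fieldType).
Implicit Types (V W U : lmodType K).

(* lin f is linear f, as a constant that the tactic lin_step can match on. *)
Definition lin V U (f : V -> U) : Prop := forall c, {morph f : x y / c *: x + y}.

Definition bilin V W U (f : V -> W -> U) : Prop :=
  (forall w, lin (f^~ w)) /\ (forall v, lin (f v)).

Lemma linP V U (f : {linear V -> U}) : lin f.
Proof. by move=> c x y; rewrite linearP. Qed.

Lemma lin0 V U (f : V -> U) : lin f -> f 0 = 0.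
Proof.
move=> lf; have := lf 1 0 0; rewrite !scale1r addr0.
by move/(congr1 (+%R^~ (- f 0))); rewrite addrK subrr.
Qed.

Lemma linZ V U (f : V -> U) : lin f -> forall c x, f (c *: x) = c *: f x.
Proof. by move=> lf c x; rewrite -[c *: x]addr0 lf lin0 ?addr0. Qed.

Lemma lin_sum V U (f : V -> U) I (r : seq I) (F : I -> V) : lin f ->
  f (\sum_(i <- r) F i) = \sum_(i <- r) f (F i).
Proof.
move=> lf; elim: r => [|i r IH]; first by rewrite !big_nil lin0.
by rewrite !big_cons -[F i]scale1r lf !scale1r IH.
Qed.

Lemma lin_tsum V W U U' (f : U -> U') (t : V ⊗ W) (F : V -> W -> U) :
  lin f -> f (tsum t F) = tsum t (fun v w => f (F v w)).
Proof. exact: lin_sum. Qed.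

Lemma eq_tsum V W (U : nmodType) (t : V ⊗ W) (f g : V -> W -> U) :
  (forall v w, f v w = g v w) -> tsum t f = tsum t g.
Proof. by move=> fg; apply: eq_bigr => p _; exact: fg. Qed.

Lemma exchange_tsum V W V' W' (U : nmodType) (t : V ⊗ W) (u : V' ⊗ W')
    (F : V -> W -> V' -> W' -> U) :
  tsum t (fun v w => tsum u (fun v' w' => F v w v' w')) =
  tsum u (fun v' w' => tsum t (fun v w => F v w v' w')).
Proof. exact: exchange_big. Qed.

Lemma tens_eq_sum V W U (f : V -> W -> U) (s s' : seq (V * W)) : bilin f ->
  tens_eq s s' -> \sum_(p <- s) f p.1 p.2 = \sum_(p <- s') f p.1 p.2.
Proof.
move=> [fl fr]; elim=> {s s'} //.
- by move=> s t u _ -> _ ->.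
- by move=> s s' t t' _ IHs _ IHt; rewrite !big_cat IHs IHt.
- by move=> s t; rewrite !big_cat /= addrC.
- move=> v v' w; rewrite !big_cons !big_nil !addr0 /=.
  by have := fl w 1 v v'; rewrite /= !scale1r.
- move=> v w w'; rewrite !big_cons !big_nil !addr0 /=.
  by have := fr v 1 w w'; rewrite !scale1r.
- move=> c v w; rewrite !big_seq1 /=.
  by rewrite (linZ (fl w)) (linZ (fr v)).
- by move=> w; rewrite big_seq1 big_nil; exact: (lin0 (fl w)).
Qed.

Lemma tsum_pi V W U (f : V -> W -> U) (s : seq (V * W)) : bilin f ->
  tsum (\pi_(V ⊗ W) s) f = \sum_(p <- s) f p.1 p.2.
Proof. by move=> bf; apply: tens_eq_sum bf _; exact: tens_reprP. Qed.

Lemma tsum_tens V W U (f : V -> W -> U) v w : bilin f -> tsum (v ⊗ w) f = f v w.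
Proof. by move=> bf; rewrite tsum_pi // big_seq1. Qed.

Lemma lin_tsuml V W U (f : V -> W -> U) : bilin f ->
  lin (fun t : V ⊗ W => tsum t f).
Proof.
move=> bf c; elim/tens_piW=> s; elim/tens_piW=> t.
rewrite tens_scaleE tens_addE !tsum_pi // big_cat big_map scaler_sumr; congr (_ + _).
apply: eq_bigr => p _ /=.
by rewrite (linZ (bf.1 p.2)).
Qed.

Lemma lin_tsumr V W U V' (F : V' -> V -> W -> U) (t : V ⊗ W) :
  (forall v w, lin (fun x => F x v w)) -> lin (fun x => tsum t (F x)).
Proof.
move=> lF c x y; rewrite /tsum scaler_sumr -big_split /=.
by apply: eq_bigr => p _; exact: lF.
Qed.

Lemma lin_tensl V W (w : W) : lin (fun v : V => v ⊗ w).
Proof.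
move=> c x y; rewrite /tens tens_scaleE tens_addE; apply/tens_piP; exact: tens_addl.
Qed.

Lemma lin_tensr V W (v : V) : lin (fun w : W => v ⊗ w).
Proof.
move=> c x y; rewrite /tens tens_scaleE tens_addE; apply/tens_piP.
apply: tens_trans (tens_addr _ _ _) _; rewrite -cat1s -[_ :: _]cat1s.
by apply: tens_cat; [apply: tens_sym; exact: tens_scale | exact: tens_refl].
Qed.

Lemma bilin_tens V W : bilin (@tens K V W).
Proof. by split; [exact: lin_tensl | exact: lin_tensr]. Qed.

Lemma tsum_id V W (t : V ⊗ W) : tsum t (@tens K V W) = t.
Proof.
elim/tens_piW: t => s; rewrite tsum_pi; last exact: bilin_tens.
elim: s => [|[v w] s IH]; first by rewrite big_nil.
by rewrite big_cons IH /= tens_addE.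
Qed.

Lemma lin_comp V W U (f : W -> U) (g : V -> W) :
  lin f -> lin g -> lin (fun x => f (g x)).
Proof. by move=> lf lg c x y; rewrite lg lf. Qed.

Lemma tens_ext V W U (f g : V ⊗ W -> U) : lin f -> lin g ->
  (forall v w, f (v ⊗ w) = g (v ⊗ w)) -> f =1 g.
Proof.
move=> lf lg fg t; rewrite -[t]tsum_id !lin_tsum //; exact: eq_tsum.
Qed.

Lemma tsum_tsum V W V' W' U (t : V ⊗ W) (F : V -> W -> V' ⊗ W')
    (h : V' -> W' -> U) : bilin h ->
  tsum (tsum t F) h = tsum t (fun v w => tsum (F v w) h).
Proof. by move=> bh; rewrite (lin_tsum _ _ (lin_tsuml bh)). Qed.

End TensorTheory.

HB.mixin Record isCoalgebra (K : fieldType) C of GRing.Lmodule K C := {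
  comul : C -> C ⊗ C;
  counit : C -> K;
  comul_is_linear : linear comul;
  counit_is_linear : scalar counit;
  comulA : forall c : C,
    \tsum_(c1, c2 <- comul c) \tsum_(d1, d2 <- comul c1) d1 ⊗ (d2 ⊗ c2) =
    \tsum_(c1, c2 <- comul c) \tsum_(d1, d2 <- comul c2) c1 ⊗ (d1 ⊗ d2);
  counitl : forall c : C, \tsum_(c1, c2 <- comul c) counit c1 *: c2 = c;
  counitr : forall c : C, \tsum_(c1, c2 <- comul c) counit c2 *: c1 = c
}.

#[short(type="coalgType")]
HB.structure Definition Coalgebra (K : fieldType) :=
  {C of GRing.Lmodule K C & isCoalgebra K C}.

HB.instance Definition _ (K : fieldType) (C : coalgType K) :=
  GRing.isLinear.Build K C (C ⊗ C)%type *:%R (@comul K C) comul_is_linear.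
HB.instance Definition _ (K : fieldType) (C : coalgType K) :=
  GRing.isLinear.Build K C K *%R (@counit K C) counit_is_linear.

HB.mixin Record Algebra_Coalgebra_isBialgebra (K : fieldType) B
    of GRing.Algebra K B & Coalgebra K B := {
  comul1 : comul (1 : B) = 1 ⊗ 1;
  comulM : forall x y : B, comul (x * y) =
    \tsum_(x1, x2 <- comul x) \tsum_(y1, y2 <- comul y) (x1 * y1) ⊗ (x2 * y2);
  counit1 : counit (1 : B) = 1;
  counitM : forall x y : B, counit (x * y) = counit x * counit y
}.

#[short(type="bialgType")]
HB.structure Definition Bialgebra (K : fieldType) :=
  {B of GRing.Algebra K B & Coalgebra K B & Algebra_Coalgebra_isBialgebra K B}.

HB.mixin Record Bialgebra_hasAntipode (K : fieldType) L of Bialgebra K L := {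
  antipode : L -> L;
  antipode_is_linear : linear antipode;
  antipodel : forall x : L,
    \tsum_(x1, x2 <- comul x) antipode x1 * x2 = (counit x)%:A;
  antipoder : forall x : L,
    \tsum_(x1, x2 <- comul x) x1 * antipode x2 = (counit x)%:A
}.

#[short(type="hopfAlgType")]
HB.structure Definition HopfAlgebra (K : fieldType) :=
  {L of Bialgebra K L & Bialgebra_hasAntipode K L}.

HB.instance Definition _ (K : fieldType) (L : hopfAlgType K) :=
  GRing.isLinear.Build K L L *:%R (@antipode K L) antipode_is_linear.

(* hopf_aut_antipode follows from the other fields. *)
Record hopf_automorphism (K : fieldType) (L : hopfAlgType K) (s : L -> L) :
    Prop := HopfAutomorphism {
  hopf_aut_bij : bijective s;
  hopf_aut_linear : linear s;
  hopf_aut_monoid : monoid_morphism s;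
  hopf_aut_comul : forall x,
    comul (s x) = \tsum_(x1, x2 <- comul x) s x1 ⊗ s x2;
  hopf_aut_counit : forall x, counit (s x) = counit x;
  hopf_aut_antipode : forall x, s (antipode x) = antipode (s x)
}.

Definition companion (K : fieldType) (L : hopfAlgType K) (s : L -> L) : Prop :=
  hopf_automorphism s /\ forall x, s (s x) = antipode (antipode x).

Definition almost_involutive (K : fieldType) (L : hopfAlgType K) : Prop :=
  exists s : L -> L, companion s.

Record left_module_coalgebra (K : fieldType) (H : bialgType K)
    (C : coalgType K) (act : {linear (H ⊗ C)%type -> C}) : Prop :=
    LeftModuleCoalgebra {
  lmc_act1 : forall c, act (1 ⊗ c) = c;
  lmc_actM : forall x y c, act ((x * y) ⊗ c) = act (x ⊗ act (y ⊗ c));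
  lmc_comul : forall x c, comul (act (x ⊗ c)) =
    \tsum_(x1, x2 <- comul x) \tsum_(c1, c2 <- comul c)
      act (x1 ⊗ c1) ⊗ act (x2 ⊗ c2);
  lmc_counit : forall x c, counit (act (x ⊗ c)) = counit x * counit c
}.

Record right_module_coalgebra (K : fieldType) (A : bialgType K)
    (C : coalgType K) (act : {linear (C ⊗ A)%type -> C}) : Prop :=
    RightModuleCoalgebra {
  rmc_act1 : forall c, act (c ⊗ 1) = c;
  rmc_actM : forall c a b, act (c ⊗ (a * b)) = act (act (c ⊗ a) ⊗ b);
  rmc_comul : forall c a, comul (act (c ⊗ a)) =
    \tsum_(c1, c2 <- comul c) \tsum_(a1, a2 <- comul a)
      act (c1 ⊗ a1) ⊗ act (c2 ⊗ a2);
  rmc_counit : forall c a, counit (act (c ⊗ a)) = counit c * counit a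
}.

Record matched_pair (K : fieldType) (A H : hopfAlgType K) := MatchedPair {
  lact : {linear (H ⊗ A)%type -> A};
  ract : {linear (H ⊗ A)%type -> H};
  mp_left : left_module_coalgebra lact;
  mp_right : right_module_coalgebra ract;
  mp_lactM : forall x a b, lact (x ⊗ (a * b)) =
    \tsum_(x1, x2 <- comul x) \tsum_(a1, a2 <- comul a)
      lact (x1 ⊗ a1) * lact (ract (x2 ⊗ a2) ⊗ b);
  mp_lact1 : forall x, lact (x ⊗ 1) = (counit x)%:A;
  mp_ractM : forall x y a, ract ((x * y) ⊗ a) =
    \tsum_(y1, y2 <- comul y) \tsum_(a1, a2 <- comul a)
      ract (x ⊗ lact (y1 ⊗ a1)) * ract (y2 ⊗ a2);
  mp_ract1 : forall a, ract (1 ⊗ a) = (counit a)%:A;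
  mp_swap : forall x a,
    \tsum_(x1, x2 <- comul x) \tsum_(a1, a2 <- comul a)
      ract (x1 ⊗ a1) ⊗ lact (x2 ⊗ a2) =
    \tsum_(x1, x2 <- comul x) \tsum_(a1, a2 <- comul a)
      ract (x2 ⊗ a2) ⊗ lact (x1 ⊗ a1)
}.

Section LinLemmas.
Context (K : fieldType).
Implicit Types (V W U : lmodType K).

Lemma lin_id V : lin (fun x : V => x).
Proof. by []. Qed.

Lemma lin_mull V (A : algType K) (g : V -> A) b :
  lin g -> lin (fun x => g x * b).
Proof. by move=> lg c x y; rewrite lg mulrDl scalerAl. Qed.

Lemma lin_mulr V (A : algType K) (g : V -> A) b :
  lin g -> lin (fun x => b * g x).
Proof. by move=> lg c x y; rewrite lg mulrDr scalerAr. Qed.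

Lemma lin_scalel V W U (k : {scalar W}) (g : V -> W) (b : U) :
  lin g -> lin (fun x => k (g x) *: b).
Proof. by move=> lg c x y; rewrite lg linearP /= scalerDl scalerA. Qed.

Lemma lin_scaler V U (g : V -> U) (k : K) :
  lin g -> lin (fun x => k *: g x).
Proof.
by move=> lg c x y; rewrite lg scalerDr !scalerA mulrC.
Qed.

End LinLemmas.

Ltac lin_step :=
  cbv beta;
  match goal with
  | |- bilin _ => split; intro
  | |- lin (fun x => x) => apply: lin_id
  | |- lin (fun x => tsum ?t (fun v w => @?F x v w)) =>
      apply: (@lin_tsumr _ _ _ _ _ F t); intros ? ?
  | |- lin (fun x => tsum (@?g x) ?F) =>
      apply: (@lin_comp _ _ _ _ (fun t => tsum t F) g); [apply: lin_tsuml|]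
  | |- lin (fun x => tens (@?g x) ?w) =>
      apply: (@lin_comp _ _ _ _ (fun v => tens v w) g); [apply: lin_tensl|]
  | |- lin (fun x => tens ?v (@?g x)) =>
      apply: (@lin_comp _ _ _ _ (fun w => tens v w) g); [apply: lin_tensr|]
  | |- lin (fun x => GRing.mul (@?g x) ?b) => apply: (@lin_mull _ _ _ g b)
  | |- lin (fun x => GRing.mul ?b (@?g x)) => apply: (@lin_mulr _ _ _ g b)
  | |- lin (fun x => GRing.scale (counit (@?g x)) ?b) =>
      apply: (@lin_scalel _ _ _ _ counit g b)
  | |- lin (fun x => GRing.scale ?k (@?g x)) => apply: (@lin_scaler _ _ _ g k)
  | |- lin (fun x => comul (@?g x)) =>
      apply: (@lin_comp _ _ _ _ comul g); [apply: linP|]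
  | |- lin (fun x => antipode (@?g x)) =>
      apply: (@lin_comp _ _ _ _ antipode g); [apply: linP|]
  | |- lin (fun x => GRing.Linear.sort ?f (@?g x)) =>
      apply: (@lin_comp _ _ _ _ f g); [apply: linP|]
  end.
Ltac lin_auto := repeat lin_step.

Section Sweedler.
Context (K : fieldType).
Implicit Types (U : lmodType K) (C : coalgType K).

Lemma sw_coassoc C U (F : C -> C -> C -> U) c :
  (forall y z, lin (fun x => F x y z)) -> (forall x z, lin (fun y => F x y z)) ->
  (forall x y, lin (fun z => F x y z)) ->
  \tsum_(c1, c2 <- comul c) \tsum_(d1, d2 <- comul c1) F d1 d2 c2 =
  \tsum_(c1, c2 <- comul c) \tsum_(d1, d2 <- comul c2) F c1 d1 d2.
Proof.
move=> l1 l2 l3.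
pose G (t : (C ⊗ (C ⊗ C))%type) := \tsum_(a, u <- t) \tsum_(b, d <- u) F a b d.
have b1 a : bilin (F a) by split=> *; [apply: l2 | apply: l3].
have b2 : bilin (fun a (u : (C ⊗ C)%type) => \tsum_(b, d <- u) F a b d).
  by split=> [u|a]; [apply: lin_tsumr => *; exact: l1 | exact: lin_tsuml].
have lG : lin G by apply: lin_tsuml.
have := congr1 G (comulA c); rewrite !(lin_tsum _ _ lG).
under eq_tsum => c1 c2.
  rewrite (lin_tsum _ _ lG).
  under eq_tsum => d1 d2 do rewrite /G tsum_tens // tsum_tens //.
  over.
move=> ->; apply: eq_tsum => c1 c2; rewrite (lin_tsum _ _ lG).
by apply: eq_tsum => d1 d2; rewrite /G tsum_tens // tsum_tens.
Qed.

Lemma sw_counitl C U (f : C -> U) c : lin f ->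
  \tsum_(c1, c2 <- comul c) counit c1 *: f c2 = f c.
Proof.
move=> lf; rewrite -[in RHS](counitl c) (lin_tsum _ _ lf).
by apply: eq_tsum => c1 c2; rewrite (linZ lf).
Qed.

Lemma sw_counitr C U (f : C -> U) c : lin f ->
  \tsum_(c1, c2 <- comul c) counit c2 *: f c1 = f c.
Proof.
move=> lf; rewrite -[in RHS](counitr c) (lin_tsum _ _ lf).
by apply: eq_tsum => c1 c2; rewrite (linZ lf).
Qed.

Lemma sw_comulM (B : bialgType K) U (F : B -> B -> U) x y : bilin F ->
  tsum (comul (x * y)) F = \tsum_(x1, x2 <- comul x) \tsum_(y1, y2 <- comul y)
    F (x1 * y1) (x2 * y2).
Proof.
move=> bF; rewrite comulM tsum_tsum //; apply: eq_tsum => x1 x2.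
rewrite tsum_tsum //; apply: eq_tsum => y1 y2; exact: tsum_tens.
Qed.

End Sweedler.

Definition sw2 (K : fieldType) (C D : coalgType K) (U : nmodType) (x : C) (a : D)
    (F : C -> D -> C -> D -> U) : U :=
  \tsum_(x1, x2 <- comul x) \tsum_(a1, a2 <- comul a) F x1 a1 x2 a2.

Section Sweedler2.
Context (K : fieldType) (C D : coalgType K).
Implicit Types (U V : lmodType K).

Lemma eq_sw2 (U : nmodType) (x : C) (a : D) (F G : C -> D -> C -> D -> U) :
  (forall x1 a1 x2 a2, F x1 a1 x2 a2 = G x1 a1 x2 a2) -> sw2 x a F = sw2 x a G.
Proof.
by move=> FG; apply: eq_tsum => x1 x2; apply: eq_tsum => a1 a2; exact: FG.
Qed.

Lemma lin_sw2 U V (f : U -> V) (x : C) (a : D) (F : C -> D -> C -> D -> U) :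
  lin f -> f (sw2 x a F) = sw2 x a (fun x1 a1 x2 a2 => f (F x1 a1 x2 a2)).
Proof.
by move=> lf; rewrite (lin_tsum _ _ lf); apply: eq_tsum => *; exact: lin_tsum.
Qed.

Lemma exchange_sw2_tsum (V W : lmodType K) (U : nmodType) (t : V ⊗ W)
    (x : C) (a : D) (F : V -> W -> C -> D -> C -> D -> U) :
  tsum t (fun v w => sw2 x a (F v w)) =
  sw2 x a (fun x1 a1 x2 a2 => tsum t (fun v w => F v w x1 a1 x2 a2)).
Proof.
rewrite exchange_tsum; apply: eq_tsum => x1 x2; exact: exchange_tsum.
Qed.

Definition lin6 U (F : C -> D -> C -> D -> C -> D -> U) : Prop :=
  (forall a1 x2 a2 x3 a3,
      lin (fun x1 => F x1 a1 x2 a2 x3 a3)) /\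
  (forall x1 x2 a2 x3 a3,
      lin (fun a1 => F x1 a1 x2 a2 x3 a3)) /\
  (forall x1 a1 a2 x3 a3,
      lin (fun x2 => F x1 a1 x2 a2 x3 a3)) /\
  (forall x1 a1 x2 x3 a3,
      lin (fun a2 => F x1 a1 x2 a2 x3 a3)) /\
  (forall x1 a1 x2 a2 a3,
      lin (fun x3 => F x1 a1 x2 a2 x3 a3)) /\
  (forall x1 a1 x2 a2 x3,
      lin (fun a3 => F x1 a1 x2 a2 x3 a3)).

Definition lin8 U (F : C -> D -> C -> D -> C -> D -> C -> D -> U) : Prop :=
  (forall a1 x2 a2 x3 a3 x4 a4,
      lin (fun x1 => F x1 a1 x2 a2 x3 a3 x4 a4)) /\
  (forall x1 x2 a2 x3 a3 x4 a4,
      lin (fun a1 => F x1 a1 x2 a2 x3 a3 x4 a4)) /\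
  (forall x1 a1 a2 x3 a3 x4 a4,
      lin (fun x2 => F x1 a1 x2 a2 x3 a3 x4 a4)) /\
  (forall x1 a1 x2 x3 a3 x4 a4,
      lin (fun a2 => F x1 a1 x2 a2 x3 a3 x4 a4)) /\
  (forall x1 a1 x2 a2 a3 x4 a4,
      lin (fun x3 => F x1 a1 x2 a2 x3 a3 x4 a4)) /\
  (forall x1 a1 x2 a2 x3 x4 a4,
      lin (fun a3 => F x1 a1 x2 a2 x3 a3 x4 a4)) /\
  (forall x1 a1 x2 a2 x3 a3 a4,
      lin (fun x4 => F x1 a1 x2 a2 x3 a3 x4 a4)) /\
  (forall x1 a1 x2 a2 x3 a3 x4,
      lin (fun a4 => F x1 a1 x2 a2 x3 a3 x4 a4)).

Lemma sw2_coassoc U (F : C -> D -> C -> D -> C -> D -> U) x a : lin6 F ->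
  sw2 x a (fun x1 a1 x2 a2 => sw2 x1 a1 (fun y1 b1 y2 b2 =>
    F y1 b1 y2 b2 x2 a2)) =
  sw2 x a (fun x1 a1 x2 a2 => sw2 x2 a2 (fun y1 b1 y2 b2 =>
    F x1 a1 y1 b1 y2 b2)).
Proof.
move=> [l1 [l2 [l3 [l4 [l5 l6]]]]]; rewrite /sw2.
transitivity (\tsum_(x1, x2 <- comul x) \tsum_(y1, y2 <- comul x1)
    \tsum_(a1, a2 <- comul a) \tsum_(b1, b2 <- comul a2) F y1 a1 y2 b1 x2 b2).
  apply: eq_tsum => x1 x2; rewrite exchange_tsum; apply: eq_tsum => y1 y2.
  by rewrite (@sw_coassoc _ _ _ (fun a b c => F y1 a y2 b x2 c)).
rewrite (@sw_coassoc _ _ _ (fun y1 y2 x2 => \tsum_(a1, a2 <- comul a)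
    \tsum_(b1, b2 <- comul a2) F y1 a1 y2 b1 x2 b2)); [|by move=> y z; lin_auto..].
by apply: eq_tsum => x1 x2; rewrite exchange_tsum.
Qed.

Lemma sw2_coassoc4 U (F : C -> D -> C -> D -> C -> D -> C -> D -> U) x a :
  lin8 F ->
  sw2 x a (fun x1 a1 x2 a2 => sw2 x1 a1 (fun y1 b1 y2 b2 =>
    sw2 x2 a2 (fun z1 c1 z2 c2 => F y1 b1 y2 b2 z1 c1 z2 c2))) =
  sw2 x a (fun x1 a1 x2 a2 => sw2 x2 a2 (fun y1 b1 y2 b2 =>
    sw2 y1 b1 (fun z1 c1 z2 c2 => F x1 a1 z1 c1 z2 c2 y2 b2))).
Proof.
move=> [l1 [l2 [l3 [l4 [l5 [l6 [l7 l8]]]]]]].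
rewrite (@sw2_coassoc _ (fun p q r s t u => sw2 t u (F p q r s))).
  apply: eq_sw2 => x1 a1 x2 a2.
  by rewrite (@sw2_coassoc _ (F x1 a1)); last by do ![split].
by rewrite /sw2; do ![split]; move=> *; lin_auto.
Qed.
End Sweedler2.

Lemma exchange_sw2 (K : fieldType) (C D C' D' : coalgType K) (U : nmodType) (x : C) (a : D)
    (y : C') (b : D') (F : C -> D -> C -> D -> C' -> D' -> C' -> D' -> U) :
  sw2 x a (fun x1 a1 x2 a2 => sw2 y b (F x1 a1 x2 a2)) =
  sw2 y b (fun y1 b1 y2 b2 => sw2 x a (fun x1 a1 x2 a2 =>
    F x1 a1 x2 a2 y1 b1 y2 b2)).
Proof.
transitivity (\tsum_(x1, x2 <- comul x) sw2 y b (fun y1 b1 y2 b2 =>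
    \tsum_(a1, a2 <- comul a) F x1 a1 x2 a2 y1 b1 y2 b2)).
  by apply: eq_tsum => x1 x2; exact: exchange_sw2_tsum.
by rewrite exchange_sw2_tsum.
Qed.

Section Bicrossed.
Context (K : fieldType) (A H : hopfAlgType K) (M : matched_pair A H).

Local Notation "x ▷ a" := (lact M (x ⊗ a))
  (at level 40, left associativity) : ring_scope.
Local Notation "x ◁ a" := (ract M (x ⊗ a))
  (at level 40, left associativity) : ring_scope.
Local Notation AH := (A ⊗ H)%type.

Implicit Types (u v w : AH) (a b c : A) (x y z : H).

Definition bic_mul u v : AH :=
  \tsum_(a, x <- u) \tsum_(b, y <- v)
    \tsum_(x1, x2 <- comul x) \tsum_(b1, b2 <- comul b)
      (a * (x1 ▷ b1)) ⊗ ((x2 ◁ b2) * y).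

Definition bic_comul u : (AH ⊗ AH)%type :=
  \tsum_(a, x <- u) \tsum_(a1, a2 <- comul a) \tsum_(x1, x2 <- comul x)
    (a1 ⊗ x1) ⊗ (a2 ⊗ x2).

Definition bic_counit u : K := \tsum_(a, x <- u) counit a * counit x.

(* Through the embeddings a |-> a ⊗ 1 and x |-> 1 ⊗ x, this is
   a ⊗ x |-> S(x) S(a). *)
Definition bic_antipode u : AH :=
  \tsum_(a, x <- u) bic_mul (1 ⊗ antipode x) (antipode a ⊗ 1).

Lemma bic_mul_bilin : bilin bic_mul.
Proof. by rewrite /bic_mul; lin_auto. Qed.

Let bic_mull v : lin (bic_mul^~ v). Proof. exact: bic_mul_bilin.1. Qed.
Let bic_mulr u : lin (bic_mul u). Proof. exact: bic_mul_bilin.2. Qed.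

Lemma bic_mulE a x b y : bic_mul (a ⊗ x) (b ⊗ y) =
  sw2 x b (fun x1 b1 x2 b2 => (a * (x1 ▷ b1)) ⊗ ((x2 ◁ b2) * y)).
Proof. by rewrite /bic_mul tsum_tens ?tsum_tens //; lin_auto. Qed.

Lemma lin_bic_comul : lin bic_comul.
Proof. by rewrite /bic_comul; lin_auto. Qed.

Lemma bic_comulE a x : bic_comul (a ⊗ x) =
  sw2 a x (fun a1 x1 a2 x2 => (a1 ⊗ x1) ⊗ (a2 ⊗ x2)).
Proof. by rewrite /bic_comul tsum_tens //; lin_auto. Qed.

Lemma sw_bic_comul (U : lmodType K) a x (F : AH -> AH -> U) : bilin F ->
  tsum (bic_comul (a ⊗ x)) F =
  sw2 a x (fun a1 x1 a2 x2 => F (a1 ⊗ x1) (a2 ⊗ x2)).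
Proof.
move=> bF; rewrite bic_comulE (lin_sw2 _ _ _ (lin_tsuml bF)).
by apply: eq_sw2 => *; exact: tsum_tens.
Qed.

Lemma bic_counit_bilin : bilin (fun a x => (counit a * counit x : K^o)).
Proof.
split=> [x|a] c y z; rewrite linearP /=; first by rewrite mulrDl -mulrA.
by rewrite mulrDr mulrCA.
Qed.

Lemma bic_counit_scalar : scalar bic_counit.
Proof. exact: (@lin_tsuml _ _ _ _ _ bic_counit_bilin). Qed.

Lemma bic_counitE a x : bic_counit (a ⊗ x) = counit a * counit x.
Proof. exact: (@tsum_tens _ _ _ _ _ _ _ bic_counit_bilin). Qed.

Lemma lin_bic_antipode : lin bic_antipode.
Proof.
apply: lin_tsuml; split=> [x|a].
  by apply: lin_comp (bic_mulr _) _; lin_auto.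
by apply: (lin_comp (bic_mull _)); lin_auto.
Qed.

Lemma bic_antipodeE a x :
  bic_antipode (a ⊗ x) = bic_mul (1 ⊗ antipode x) (antipode a ⊗ 1).
Proof.
rewrite /bic_antipode tsum_tens //; split=> [x'|a'].
  by apply: lin_comp (bic_mulr _) _; lin_auto.
by apply: (lin_comp (bic_mull _)); lin_auto.
Qed.

Ltac lin_var := lin_auto; try by [];
  match goal with
  | l : forall _ _ _, lin _ |- lin (fun t => ?F (@?g t) ?a ?y ?b) =>
      refine (@lin_comp _ _ _ _ _ g (l a y b) _)
  | l : forall _ _ _, lin _ |- lin (fun t => ?F ?x (@?g t) ?y ?b) =>
      refine (@lin_comp _ _ _ _ _ g (l x y b) _)
  | l : forall _ _ _, lin _ |- lin (fun t => ?F ?x ?a (@?g t) ?b) =>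
      refine (@lin_comp _ _ _ _ _ g (l x a b) _)
  | l : forall _ _ _, lin _ |- lin (fun t => ?F ?x ?a ?y (@?g t)) =>
      refine (@lin_comp _ _ _ _ _ g (l x a y) _)
  end; lin_auto.

Lemma sw2_ract_mul (U : lmodType K) x y b c (F : H -> A -> H -> A -> U) :
  (forall a' y' b', lin (fun x => F x a' y' b')) ->
  (forall x' a' b', lin (fun y => F x' a' y b')) ->
  sw2 ((x ◁ b) * y) c F =
  sw2 x b (fun p1 q1 p2 q2 => sw2 y c (fun y1 c1 y2 c2 =>
    F ((p1 ◁ q1) * y1) c1 ((p2 ◁ q2) * y2) c2)).
Proof.
move=> l1 l3; rewrite {1}/sw2 sw_comulM; last by lin_var.
rewrite (rmc_comul (mp_right M)) tsum_tsum; last by lin_var.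
apply: eq_tsum => p1 p2; rewrite tsum_tsum; last by lin_var.
by apply: eq_tsum => q1 q2; rewrite tsum_tens //; lin_var.
Qed.

Lemma sw2_mul_lact (U : lmodType K) x y b c (F : H -> A -> H -> A -> U) :
  (forall x' y' b', lin (fun a => F x' a y' b')) ->
  (forall x' a' y', lin (fun b => F x' a' y' b)) ->
  sw2 x (b * (y ▷ c)) F =
  sw2 x b (fun x1 b1 x2 b2 => sw2 y c (fun p1 q1 p2 q2 =>
    F x1 (b1 * (p1 ▷ q1)) x2 (b2 * (p2 ▷ q2)))).
Proof.
move=> l2 l4; apply: eq_tsum => x1 x2; rewrite sw_comulM; last by lin_var.
apply: eq_tsum => b1 b2.
rewrite (lmc_comul (mp_left M)) tsum_tsum; last by lin_var.
apply: eq_tsum => p1 p2; rewrite tsum_tsum; last by lin_var.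
by apply: eq_tsum => q1 q2; rewrite tsum_tens //; lin_var.
Qed.

Lemma bic_mulA_tens a x b y c z :
  bic_mul (a ⊗ x) (bic_mul (b ⊗ y) (c ⊗ z)) =
  bic_mul (bic_mul (a ⊗ x) (b ⊗ y)) (c ⊗ z).
Proof.
pose F x1 b1 x2 b2 x3 b3 y1 c1 y2 c2 y3 c3 : AH :=
  (a * (x1 ▷ b1) * ((x2 ◁ b2) ▷ (y1 ▷ c1)))
    ⊗ (((x3 ◁ b3) ◁ (y2 ▷ c2)) * ((y3 ◁ c3) * z)).
transitivity (sw2 x b (fun x1 b1 x2 b2 => sw2 x2 b2 (fun p1 q1 p2 q2 =>
  sw2 y c (fun y1 c1 y2 c2 => sw2 y2 c2 (fun r1 s1 r2 s2 =>
    F x1 b1 p1 q1 p2 q2 y1 c1 r1 s1 r2 s2))))).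
  rewrite (bic_mulE b) (lin_sw2 _ _ _ (bic_mulr _)).
  transitivity (sw2 y c (fun y1 c1 y2 c2 => sw2 x b (fun x1 b1 x2 b2 =>
    sw2 y1 c1 (fun p1 q1 p2 q2 => sw2 x1 b1 (fun r1 s1 r2 s2 =>
      F r1 s1 r2 s2 x2 b2 p1 q1 p2 q2 y2 c2))))).
    apply: eq_sw2 => y1 c1 y2 c2; rewrite bic_mulE sw2_mul_lact; first last.
    - by move=> *; lin_auto.
    - by move=> *; lin_auto.
    apply: eq_sw2 => x1 b1 x2 b2; apply: eq_sw2 => p1 q1 p2 q2.
    rewrite (mp_lactM M) (rmc_actM (mp_right M)).
    pose G t : AH := (a * t) ⊗ (((x2 ◁ b2) ◁ (p2 ▷ q2)) * ((y2 ◁ c2) * z)).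
    have lG : lin G by rewrite /G; lin_auto.
    transitivity (G (sw2 x1 b1 (fun r1 s1 r2 s2 =>
      (r1 ▷ s1) * ((r2 ◁ s2) ▷ (p1 ▷ q1))))); first by [].
    rewrite (lin_sw2 _ _ _ lG).
    by apply: eq_sw2 => r1 s1 r2 s2; rewrite /G /F mulrA.
  rewrite exchange_sw2.
  transitivity (sw2 x b (fun x1 b1 x2 b2 => sw2 x1 b1 (fun p1 q1 p2 q2 =>
    sw2 y c (fun y1 c1 y2 c2 => sw2 y2 c2 (fun r1 s1 r2 s2 =>
      F p1 q1 p2 q2 x2 b2 y1 c1 r1 s1 r2 s2))))).
    apply: eq_sw2 => x1 b1 x2 b2.
    rewrite (@sw2_coassoc _ _ _ _ (fun y1 c1 y2 c2 y3 c3 => sw2 x1 b1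
      (fun r1 s1 r2 s2 => F r1 s1 r2 s2 x2 b2 y1 c1 y2 c2 y3 c3))).
      rewrite exchange_sw2; apply: eq_sw2 => y1 c1 y2 c2.
      by rewrite exchange_sw2.
    by rewrite /F /sw2; do ![split]; move=> *; lin_auto.
  rewrite (@sw2_coassoc _ _ _ _ (fun x1 b1 x2 b2 x3 b3 =>
    sw2 y c (fun y1 c1 y2 c2 => sw2 y2 c2 (fun r1 s1 r2 s2 =>
      F x1 b1 x2 b2 x3 b3 y1 c1 r1 s1 r2 s2)))) //.
  by rewrite /F /sw2; do ![split]; move=> *; lin_auto.
rewrite (bic_mulE a) (lin_sw2 _ _ _ (bic_mull _)).
apply: eq_sw2 => x1 b1 x2 b2; rewrite bic_mulE sw2_ract_mul; first last.
- by move=> *; lin_auto.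
- by move=> *; lin_auto.
apply: eq_sw2 => p1 q1 p2 q2; apply: eq_sw2 => y1 c1 y2 c2; symmetry.
rewrite (lmc_actM (mp_left M)) (mp_ractM M).
pose G t : AH := (a * (x1 ▷ b1) * ((p1 ◁ q1) ▷ (y1 ▷ c1))) ⊗ (t * z).
have lG : lin G by rewrite /G; lin_auto.
transitivity (G (sw2 y2 c2 (fun r1 s1 r2 s2 =>
  ((p2 ◁ q2) ◁ (r1 ▷ s1)) * (r2 ◁ s2)))); first by [].
rewrite (lin_sw2 _ _ _ lG).
by apply: eq_sw2 => r1 s1 r2 s2; rewrite /G /F -[_ * _ * z]mulrA.
Qed.

Lemma bic_mulA : associative bic_mul.
Proof.
move=> u v w; apply: (tens_ext (f := fun u => bic_mul u (bic_mul v w))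
  (g := fun u => bic_mul (bic_mul u v) w)) => [||a x] {u}.
- exact: bic_mull.
- exact: lin_comp (bic_mull _) (bic_mull _).
apply: (tens_ext (f := fun v => bic_mul _ (bic_mul v w))
  (g := fun v => bic_mul (bic_mul _ v) w)) => [||b y] {v}.
- exact: lin_comp (bic_mulr _) (bic_mull _).
- exact: lin_comp (bic_mull _) (bic_mulr _).
apply: (tens_ext (f := fun w => bic_mul _ (bic_mul _ w))
  (g := fun w => bic_mul (bic_mul _ _) w)) => [||c z] {w}.
- exact: lin_comp (bic_mulr _) (bic_mulr _).
- exact: bic_mulr.
exact: bic_mulA_tens.
Qed.

Lemma bic_mul_l1 a b y : bic_mul (a ⊗ 1) (b ⊗ y) = (a * b) ⊗ y.
Proof.
rewrite bic_mulE /sw2 comul1 tsum_tens; last by lin_auto.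
rewrite -[RHS](@sw_counitr _ _ _ (fun b => (a * b) ⊗ y)); last by lin_auto.
apply: eq_tsum => b1 b2; rewrite (lmc_act1 (mp_left M)) (mp_ract1 M).
by rewrite -scalerAl mul1r (linZ (lin_tensr _)).
Qed.

Lemma bic_mul_r1 a x y : bic_mul (a ⊗ x) (1 ⊗ y) = a ⊗ (x * y).
Proof.
rewrite bic_mulE /sw2 comul1.
rewrite -[RHS](@sw_counitl _ _ _ (fun x => a ⊗ (x * y))); last by lin_auto.
apply: eq_tsum => x1 x2; rewrite tsum_tens; last by lin_auto.
rewrite (rmc_act1 (mp_right M)) (mp_lact1 M) -scalerAr mulr1.
by rewrite (linZ (lin_tensl _)).
Qed.

Lemma bic_mul1 : left_id (1 ⊗ 1) bic_mul.
Proof.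
apply: tens_ext => [||b y]; [exact: bic_mulr | exact: lin_id |].
by rewrite bic_mul_l1 mul1r.
Qed.

Lemma bic_mulr1 : right_id (1 ⊗ 1) bic_mul.
Proof.
apply: (tens_ext (f := bic_mul^~ _) (g := id)) => [||b y].
- exact: bic_mull.
- exact: lin_id.
by rewrite bic_mul_r1 mulr1.
Qed.

Lemma bic_mulDl : left_distributive bic_mul +%R.
Proof. by move=> u v w; have := bic_mull w 1 u v; rewrite !scale1r. Qed.

Lemma bic_mulDr : right_distributive bic_mul +%R.
Proof. by move=> u v w; have := bic_mulr u 1 v w; rewrite !scale1r. Qed.

Lemma bic_one_neq0 : (1 ⊗ 1 : AH) != 0.
Proof.
apply/eqP => /(congr1 bic_counit); rewrite bic_counitE !counit1 mulr1.
by rewrite (lin0 (bic_counit_scalar : lin (bic_counit : AH -> K^o))); apply/eqP;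
   rewrite oner_eq0.
Qed.

Lemma bic_scalerAl (k : K) u v : k *: bic_mul u v = bic_mul (k *: u) v.
Proof. by rewrite (linZ (bic_mull v)). Qed.

Lemma bic_scalerAr (k : K) u v : k *: bic_mul u v = bic_mul u (k *: v).
Proof. by rewrite (linZ (bic_mulr u)). Qed.

Lemma bic_comulA u :
  \tsum_(u1, u2 <- bic_comul u) \tsum_(v1, v2 <- bic_comul u1)
    v1 ⊗ (v2 ⊗ u2) =
  \tsum_(u1, u2 <- bic_comul u) \tsum_(v1, v2 <- bic_comul u2)
    u1 ⊗ (v1 ⊗ v2).
Proof.
have b1 : bilin (fun u1 u2 : AH => \tsum_(v1, v2 <- bic_comul u1)
    v1 ⊗ (v2 ⊗ u2)).
  split=> v; last by lin_auto.
  apply: (lin_comp (f := fun t => \tsum_(v1, v2 <- t) v1 ⊗ (v2 ⊗ v))).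
    by apply: lin_tsuml; lin_auto.
  exact: lin_bic_comul.
have b2 : bilin (fun u1 u2 : AH => \tsum_(v1, v2 <- bic_comul u2)
    u1 ⊗ (v1 ⊗ v2)).
  split=> v; first by lin_auto.
  apply: (lin_comp (f := fun t => \tsum_(v1, v2 <- t) v ⊗ (v1 ⊗ v2))).
    by apply: lin_tsuml; lin_auto.
  exact: lin_bic_comul.
apply: (tens_ext (f := fun u => tsum (bic_comul u) _)
  (g := fun u => tsum (bic_comul u) _)) => [||a x] {u}.
- exact: lin_comp (lin_tsuml b1) lin_bic_comul.
- exact: lin_comp (lin_tsuml b2) lin_bic_comul.
rewrite !sw_bic_comul //.
under eq_sw2 => a1 x1 a2 x2.
  rewrite sw_bic_comul; last by lin_auto.
  over.
rewrite (@sw2_coassoc _ _ _ _ (fun a1 x1 a2 x2 a3 x3 =>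
  (a1 ⊗ x1) ⊗ ((a2 ⊗ x2) ⊗ (a3 ⊗ x3)))); last first.
  by do ![split]; move=> *; lin_auto.
by apply: eq_sw2 => *; rewrite sw_bic_comul //; lin_auto.
Qed.

Lemma bic_counitl u : \tsum_(u1, u2 <- bic_comul u) bic_counit u1 *: u2 = u.
Proof.
have bF : bilin (fun u1 u2 : AH => bic_counit u1 *: u2).
  split=> [v c y z|v c y z]; first by rewrite bic_counit_scalar scalerDl scalerA.
  by rewrite scalerDr !scalerA mulrC.
apply: (tens_ext (f := fun u => tsum (bic_comul u) _) (g := id)) => [||a x].
- exact: lin_comp (lin_tsuml bF) lin_bic_comul.
- exact: lin_id.
rewrite sw_bic_comul // -[RHS](@sw_counitl _ _ _ (fun a => a ⊗ x)); last first.
  by lin_auto.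
apply: eq_tsum => a1 a2.
rewrite -[a2 ⊗ x](@sw_counitl _ _ _ (fun x => a2 ⊗ x)); last by lin_auto.
rewrite (lin_tsum _ _ (lin_scaler _ (@lin_id _ _))).
by apply: eq_tsum => x1 x2; rewrite bic_counitE scalerA.
Qed.

Lemma bic_counitr u : \tsum_(u1, u2 <- bic_comul u) bic_counit u2 *: u1 = u.
Proof.
have bF : bilin (fun u1 u2 : AH => bic_counit u2 *: u1).
  split=> [v c y z|v c y z]; last by rewrite bic_counit_scalar scalerDl scalerA.
  by rewrite scalerDr !scalerA mulrC.
apply: (tens_ext (f := fun u => tsum (bic_comul u) _) (g := id)) => [||a x].
- exact: lin_comp (lin_tsuml bF) lin_bic_comul.
- exact: lin_id.
rewrite sw_bic_comul // -[RHS](@sw_counitr _ _ _ (fun a => a ⊗ x)); last first.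
  by lin_auto.
apply: eq_tsum => a1 a2.
rewrite -[a1 ⊗ x](@sw_counitr _ _ _ (fun x => a1 ⊗ x)); last by lin_auto.
rewrite (lin_tsum _ _ (lin_scaler _ (@lin_id _ _))).
by apply: eq_tsum => x1 x2; rewrite bic_counitE scalerA.
Qed.

Lemma bic_comul1 : bic_comul (1 ⊗ 1) = (1 ⊗ 1) ⊗ (1 ⊗ 1).
Proof.
by rewrite bic_comulE /sw2 !comul1 !tsum_tens //; lin_auto.
Qed.

Lemma bic_counit1 : bic_counit (1 ⊗ 1) = 1.
Proof. by rewrite bic_counitE !counit1 mulr1. Qed.

Lemma bic_counitM u v : bic_counit (bic_mul u v) = bic_counit u * bic_counit v.
Proof.
have lc : lin (bic_counit : AH -> K^o) by exact: bic_counit_scalar.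
pose f u v : K^o := bic_counit (bic_mul u v).
pose g u v : K^o := bic_counit u * bic_counit v.
rewrite -/(f u v) -/(g u v).
apply: (tens_ext (f := f^~ v) (g := g^~ v)) => [||a x] {u}.
- exact: lin_comp lc (bic_mull _).
- by move=> c y z; rewrite /g bic_counit_scalar mulrDl -mulrA.
apply: (tens_ext (f := f _) (g := g _)) => [||b y] {v}.
- exact: lin_comp lc (bic_mulr _).
- by move=> c y z; rewrite /g bic_counit_scalar mulrDr mulrCA.
rewrite /f /g bic_mulE (lin_sw2 _ _ _ lc) !bic_counitE.
have lin_eps (C : coalgType K) (k l : K) :
    lin (fun z : C => (k * counit z * l : K^o)).
  move=> c z t; rewrite linearP /= mulrDr mulrDl; congr (_ + _).
  by rewrite mulrCA -[LHS]mulrA.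
transitivity (counit a * counit x * (counit b * counit y) : K^o); last by [].
rewrite -(@sw_counitl _ _ _ _ x (lin_eps _ _ _)); apply: eq_tsum => x1 x2.
rewrite mulrA -(@sw_counitl _ _ _ _ b (lin_eps _ _ _)).
rewrite (lin_tsum _ _ (lin_scaler _ (@lin_id _ _))); apply: eq_tsum => b1 b2.
rewrite bic_counitE !counitM (lmc_counit (mp_left M)) (rmc_counit (mp_right M)).
rewrite /GRing.scale /=.
rewrite !mulrA; congr (_ * _ * _); rewrite -!mulrA [in LHS]mulrCA.
by congr (_ * _); rewrite mulrCA.
Qed.

Lemma sw2_swap (U : lmodType K) x b (F : A -> H -> U) : bilin F ->
  sw2 x b (fun x1 b1 x2 b2 => F (x2 ▷ b2) (x1 ◁ b1)) =
  sw2 x b (fun x1 b1 x2 b2 => F (x1 ▷ b1) (x2 ◁ b2)).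
Proof.
move=> [F1 F2]; have bF : bilin (fun h a => F a h) by split.
have := congr1 (fun t => tsum t (fun h a => F a h)) (mp_swap M x b).
rewrite /= !tsum_tsum //.
under eq_tsum => x1 x2.
  rewrite tsum_tsum //; under eq_tsum do rewrite tsum_tens //; over.
rewrite {1}/sw2 => ->; apply: eq_tsum => x1 x2; rewrite tsum_tsum //.
by apply: eq_tsum => *; rewrite tsum_tens.
Qed.

Lemma sw_lact (U : lmodType K) x b (F : A -> A -> U) : bilin F ->
  tsum (comul (x ▷ b)) F =
  sw2 x b (fun x1 b1 x2 b2 => F (x1 ▷ b1) (x2 ▷ b2)).
Proof.
move=> bF; rewrite (lmc_comul (mp_left M)) tsum_tsum //.
apply: eq_tsum => x1 x2; rewrite tsum_tsum //.
by apply: eq_tsum => b1 b2; rewrite tsum_tens.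
Qed.

Lemma sw_ract (U : lmodType K) x b (F : H -> H -> U) : bilin F ->
  tsum (comul (x ◁ b)) F =
  sw2 x b (fun x1 b1 x2 b2 => F (x1 ◁ b1) (x2 ◁ b2)).
Proof.
move=> bF; rewrite (rmc_comul (mp_right M)) tsum_tsum //.
apply: eq_tsum => x1 x2; rewrite tsum_tsum //.
by apply: eq_tsum => b1 b2; rewrite tsum_tens.
Qed.

Lemma bic_comulM_tens a x b y : bic_comul (bic_mul (a ⊗ x) (b ⊗ y)) =
  \tsum_(u1, u2 <- bic_comul (a ⊗ x)) \tsum_(v1, v2 <- bic_comul (b ⊗ y))
    bic_mul u1 v1 ⊗ bic_mul u2 v2.
Proof.
pose G a1 a2 y1 y2 (b1 : A) (x1 : H) (b2 : A) (x2 : H) : (AH ⊗ AH)%type :=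
  ((a1 * b1) ⊗ (x1 * y1)) ⊗ ((a2 * b2) ⊗ (x2 * y2)).
transitivity (\tsum_(a1, a2 <- comul a) \tsum_(y1, y2 <- comul y)
  sw2 x b (fun x1 b1 x2 b2 => sw2 x1 b1 (fun p1 q1 p2 q2 =>
    sw2 x2 b2 (fun r1 s1 r2 s2 =>
      G a1 a2 y1 y2 (p1 ▷ q1) (r1 ◁ s1) (p2 ▷ q2) (r2 ◁ s2))))).
  rewrite bic_mulE (lin_sw2 _ _ _ lin_bic_comul).
  under [RHS]eq_tsum => a1 a2 do rewrite exchange_sw2_tsum.
  rewrite exchange_sw2_tsum; apply: eq_sw2 => x1 b1 x2 b2.
  rewrite bic_comulE /(sw2 (_ * _)) sw_comulM; last by lin_auto.
  apply: eq_tsum => a1 a2.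
  rewrite sw_lact; last by lin_auto.
  rewrite exchange_sw2_tsum; apply: eq_sw2 => p1 q1 p2 q2.
  rewrite sw_comulM; last by lin_auto.
  rewrite sw_ract; last by lin_auto.
  by rewrite exchange_sw2_tsum.
transitivity (\tsum_(a1, a2 <- comul a) \tsum_(y1, y2 <- comul y)
  sw2 x b (fun x1 b1 x2 b2 => sw2 x1 b1 (fun p1 q1 p2 q2 =>
    sw2 x2 b2 (fun r1 s1 r2 s2 =>
      G a1 a2 y1 y2 (p1 ▷ q1) (p2 ◁ q2) (r1 ▷ s1) (r2 ◁ s2))))).
  apply: eq_tsum => a1 a2; apply: eq_tsum => y1 y2.
  rewrite (@sw2_coassoc4 _ _ _ _ (fun p1 q1 p2 q2 r1 s1 r2 s2 =>
    G a1 a2 y1 y2 (p1 ▷ q1) (r1 ◁ s1) (p2 ▷ q2) (r2 ◁ s2))); last first.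
    by rewrite /G; do ![split]; move=> *; lin_auto.
  rewrite (@sw2_coassoc4 _ _ _ _ (fun p1 q1 p2 q2 r1 s1 r2 s2 =>
    G a1 a2 y1 y2 (p1 ▷ q1) (p2 ◁ q2) (r1 ▷ s1) (r2 ◁ s2))); last first.
    by rewrite /G; do ![split]; move=> *; lin_auto.
  apply: eq_sw2 => x1 b1 x2 b2; apply: eq_sw2 => p1 q1 p2 q2.
  rewrite -(@sw2_swap _ _ _ (fun t h =>
    G a1 a2 y1 y2 (x1 ▷ b1) h t (p2 ◁ q2))) //.
  by rewrite /G; lin_auto.
rewrite sw_bic_comul; last first.
  split=> w; apply: lin_tsumr => *.
  - exact: lin_comp (lin_tensl _) (bic_mull _).
  - exact: lin_comp (lin_tensr _) (bic_mull _).
apply: eq_tsum => a1 a2; rewrite exchange_sw2_tsum; apply: eq_tsum => x1 x2.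
rewrite sw_bic_comul; last first.
  split=> w.
  - exact: lin_comp (lin_tensl _) (bic_mulr _).
  - exact: lin_comp (lin_tensr _) (bic_mulr _).
apply: eq_tsum => b1 b2; apply: eq_tsum => y1 y2.
rewrite !bic_mulE (lin_sw2 _ _ _ (lin_tensl _)); apply: eq_sw2 => p1 q1 p2 q2.
by rewrite (lin_sw2 _ _ _ (lin_tensr _)).
Qed.

Lemma bic_comulM u v : bic_comul (bic_mul u v) =
  \tsum_(u1, u2 <- bic_comul u) \tsum_(v1, v2 <- bic_comul v)
    bic_mul u1 v1 ⊗ bic_mul u2 v2.
Proof.
have b1 u1 u2 : bilin (fun v1 v2 => bic_mul u1 v1 ⊗ bic_mul u2 v2).
  split=> w.
  - exact: lin_comp (lin_tensl _) (bic_mulr _).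
  - exact: lin_comp (lin_tensr _) (bic_mulr _).
have b2 (w : (AH ⊗ AH)%type) : bilin (fun u1 u2 => \tsum_(v1, v2 <- w)
    bic_mul u1 v1 ⊗ bic_mul u2 v2).
  split=> w'; apply: lin_tsumr => *.
  - exact: lin_comp (lin_tensl _) (bic_mull _).
  - exact: lin_comp (lin_tensr _) (bic_mull _).
apply: (tens_ext (f := fun u => bic_comul (bic_mul u v))
  (g := fun u => tsum (bic_comul u) _)) => [||a x] {u}.
- exact: lin_comp lin_bic_comul (bic_mull _).
- exact: lin_comp (lin_tsuml (b2 _)) lin_bic_comul.
apply: (tens_ext (f := fun v => bic_comul (bic_mul _ v)) (g := fun v =>
  \tsum_(u1, u2 <- bic_comul (a ⊗ x)) \tsum_(v1, v2 <- bic_comul v)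
    bic_mul u1 v1 ⊗ bic_mul u2 v2)) => [||b y] {v}.
- exact: lin_comp lin_bic_comul (bic_mulr _).
- apply: lin_tsumr => *; exact: lin_comp (lin_tsuml (b1 _ _)) lin_bic_comul.
exact: bic_comulM_tens.
Qed.

Lemma bic_mul_split a x : bic_mul (a ⊗ 1) (1 ⊗ x) = a ⊗ x.
Proof. by rewrite bic_mul_l1 mulr1. Qed.

Let bic_antipode_bilinl : bilin (fun u1 u2 => bic_mul (bic_antipode u1) u2).
Proof.
split=> w; last exact: bic_mulr.
exact: (lin_comp (bic_mull w) lin_bic_antipode).
Qed.

Let bic_antipode_bilinr : bilin (fun u1 u2 => bic_mul u1 (bic_antipode u2)).
Proof.
split=> w; first exact: bic_mull.
exact: (lin_comp (bic_mulr w) lin_bic_antipode).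
Qed.

Let lin_bic_unit : lin (fun u => bic_counit u *: (1 ⊗ 1 : AH)).
Proof. by move=> c y z; rewrite bic_counit_scalar scalerDl scalerA. Qed.

Lemma bic_antipodel u : \tsum_(u1, u2 <- bic_comul u)
  bic_mul (bic_antipode u1) u2 = bic_counit u *: (1 ⊗ 1).
Proof.
apply: (tens_ext (f := fun u => tsum (bic_comul u) _)
  (g := fun u => bic_counit u *: (1 ⊗ 1))) => [||a x] {u}.
- exact: lin_comp (lin_tsuml bic_antipode_bilinl) lin_bic_comul.
- exact: lin_bic_unit.
rewrite sw_bic_comul // bic_counitE /sw2 exchange_tsum.
transitivity (\tsum_(x1, x2 <- comul x) (counit a *:
    ((1 ⊗ (antipode x1 * x2)) : AH))).
  apply: eq_tsum => x1 x2.
  transitivity (\tsum_(a1, a2 <- comul a) bic_mul (1 ⊗ antipode x1)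
    (bic_mul ((antipode a1 * a2) ⊗ 1) (1 ⊗ x2))).
    apply: eq_tsum => a1 a2; rewrite bic_antipodeE -bic_mulA; congr bic_mul.
    by rewrite bic_mul_l1 bic_mul_split.
  rewrite -(lin_tsum _ _ (bic_mulr _)) -(lin_tsum _ _ (bic_mull _)).
  rewrite -(lin_tsum _ _ (lin_tensl _)) antipodel (linZ (lin_tensl _)).
  by rewrite (linZ (bic_mull _)) (linZ (bic_mulr _)) bic_mul_split bic_mul_r1.
rewrite -(lin_tsum _ _ (lin_scaler _ (@lin_id _ _))).
rewrite -(lin_tsum _ _ (lin_tensr _)) antipodel (linZ (lin_tensr _)).
by rewrite scalerA.
Qed.

Lemma bic_antipoder u : \tsum_(u1, u2 <- bic_comul u)
  bic_mul u1 (bic_antipode u2) = bic_counit u *: (1 ⊗ 1).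
Proof.
apply: (tens_ext (f := fun u => tsum (bic_comul u) _)
  (g := fun u => bic_counit u *: (1 ⊗ 1))) => [||a x] {u}.
- exact: lin_comp (lin_tsuml bic_antipode_bilinr) lin_bic_comul.
- exact: lin_bic_unit.
rewrite sw_bic_comul // bic_counitE.
transitivity (\tsum_(a1, a2 <- comul a) (counit x *:
    (((a1 * antipode a2) ⊗ 1) : AH))).
  apply: eq_tsum => a1 a2.
  transitivity (\tsum_(x1, x2 <- comul x) bic_mul
    (bic_mul (a1 ⊗ 1) (1 ⊗ (x1 * antipode x2))) (antipode a2 ⊗ 1)).
    apply: eq_tsum => x1 x2; rewrite bic_antipodeE bic_mulA.
    by congr bic_mul; rewrite bic_mul_r1 bic_mul_split.
  rewrite -(lin_tsum _ _ (bic_mull _)) -(lin_tsum _ _ (bic_mulr _)).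
  rewrite -(lin_tsum _ _ (lin_tensr _)) antipoder (linZ (lin_tensr _)).
  by rewrite (linZ (bic_mulr _)) (linZ (bic_mull _)) bic_mul_split bic_mul_l1.
rewrite -(lin_tsum _ _ (lin_scaler _ (@lin_id _ _))).
rewrite -(lin_tsum _ _ (lin_tensl _)) antipoder (linZ (lin_tensl _)).
by rewrite scalerA mulrC.
Qed.

End Bicrossed.

Definition bicrossed (K : fieldType) (A H : hopfAlgType K)
  (M : matched_pair A H) : Type := (A ⊗ H)%type.

Section BicrossedHopf.
Context (K : fieldType) (A H : hopfAlgType K) (M : matched_pair A H).

HB.instance Definition _ := GRing.Lmodule.copy (bicrossed M) (A ⊗ H)%type.

HB.instance Definition _ := GRing.Zmodule_isNzRing.Build (bicrossed M)
  (@bic_mulA K A H M) (@bic_mul1 K A H M) (@bic_mulr1 K A H M)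
  (@bic_mulDl K A H M) (@bic_mulDr K A H M) (@bic_one_neq0 K A H).

HB.instance Definition _ := GRing.Lmodule_isLalgebra.Build K (bicrossed M)
  (@bic_scalerAl K A H M).

HB.instance Definition _ := GRing.Lalgebra_isAlgebra.Build K (bicrossed M)
  (@bic_scalerAr K A H M).

HB.instance Definition _ := isCoalgebra.Build K (bicrossed M)
  (@lin_bic_comul K A H) (@bic_counit_scalar K A H)
  (@bic_comulA K A H) (@bic_counitl K A H) (@bic_counitr K A H).

HB.instance Definition _ := Algebra_Coalgebra_isBialgebra.Build K (bicrossed M)
  (@bic_comul1 K A H) (@bic_comulM K A H M) (@bic_counit1 K A H)
  (@bic_counitM K A H M).

HB.instance Definition _ := Bialgebra_hasAntipode.Build K (bicrossed M)
  (@lin_bic_antipode K A H M) (@bic_antipodel K A H M) (@bic_antipoder K A H M).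

Lemma bicrossed_oneE : 1 = 1 ⊗ 1 :> bicrossed M.
Proof. by []. Qed.

Lemma bicrossed_mulE (a b : A) (x y : H) :
  ((a ⊗ x : bicrossed M) * (b ⊗ y : bicrossed M)) =
  \tsum_(x1, x2 <- comul x) \tsum_(b1, b2 <- comul b)
    (a * lact M (x1 ⊗ b1)) ⊗ (ract M (x2 ⊗ b2) * y).
Proof. exact: bic_mulE. Qed.

Lemma bicrossed_comulE (a : A) (x : H) :
  comul (a ⊗ x : bicrossed M) =
  \tsum_(a1, a2 <- comul a) \tsum_(x1, x2 <- comul x)
    (a1 ⊗ x1 : bicrossed M) ⊗ (a2 ⊗ x2 : bicrossed M).
Proof. exact: bic_comulE. Qed.

Lemma bicrossed_counitE (a : A) (x : H) :
  counit (a ⊗ x : bicrossed M) = counit a * counit x.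
Proof. exact: bic_counitE. Qed.

Lemma bicrossed_antipodeE (a : A) (x : H) :
  antipode (a ⊗ x : bicrossed M) =
  (1 ⊗ antipode x : bicrossed M) * (antipode a ⊗ 1 : bicrossed M).
Proof. exact: bic_antipodeE. Qed.

End BicrossedHopf.

(* Main.v *)
Require Import Defs.
From mathcomp Require Import all_boot all_order all_algebra.
Import GRing.Theory.
Local Open Scope ring_scope.

(** The companion automorphism of the bicrossed product is the tensor product
    sigma = sA ⊗ sH.  It is always a coalgebra automorphism, and conditions
    (a) and (b) make it compatible with the product
    (a ⊗ x)(b ⊗ y) = a (x1 ▷ b1) ⊗ (x2 ◁ b2) y, since sA and sH are
    multiplicative and comultiplicative ([bic_map_mul]).

    For the square, write a x for a ⊗ x = (a ⊗ 1)(1 ⊗ x).  The antipode of a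
    Hopf algebra reverses products ([antipodeM]) and the antipode of the
    bicrossed product restricts to those of A and H, so
    S^2(a x) = S(S(x) S(a)) = S^2(a) S^2(x) ([bicrossed_antipode_sq]).  By the
    companion property of sA and sH this is sA^2(a) sH^2(x) = sigma^2(a x). *)

(** * Antipodes *)

Section Antipode.
Context {K : fieldType} {L : hopfAlgType K}.

Lemma antipode1 : antipode (1 : L) = 1.
Proof.
have := antipodel (1 : L).
by rewrite comul1 tsum_tens ?counit1 ?scale1r ?mulr1 //; lin_auto.
Qed.

(** Convolution inverses are unique: (x, y) |-> S(x y) is a left inverse and
    (x, y) |-> S(y) S(x) a right inverse of the product map.  Concretely,
    S(x1 y1) x2 y2 S(y3) S(x3) is evaluated by cancelling either the first two
    or the last two pairs of Sweedler components. *)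
Lemma antipodeM (x y : L) : antipode (x * y) = antipode y * antipode x.
Proof.
pose F x1 y1 x2 y2 x3 y3 : L :=
  antipode (x1 * y1) * (x2 * y2 * (antipode y3 * antipode x3)).
have lF : lin6 F by rewrite /F; do ![split]; move=> *; lin_auto.
have := sw2_coassoc x y lF.
have -> : sw2 x y (fun x1 y1 x2 y2 => sw2 x1 y1 (fun p1 q1 p2 q2 =>
    F p1 q1 p2 q2 x2 y2)) = antipode y * antipode x.
  transitivity (sw2 x y (fun x1 y1 x2 y2 =>
      counit x1 *: (counit y1 *: (antipode y2 * antipode x2)))).
    apply: eq_sw2 => x1 y1 x2 y2.
    transitivity ((\tsum_(z1, z2 <- comul (x1 * y1)) antipode z1 * z2) *
      (antipode y2 * antipode x2)).
      rewrite sw_comulM; last by lin_auto.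
      have l : lin (fun z => z * (antipode y2 * antipode x2)) by lin_auto.
      rewrite (lin_tsum _ _ l); apply: eq_tsum => p1 p2.
      by rewrite (lin_tsum _ _ l); apply: eq_tsum => *; rewrite /F !mulrA.
    by rewrite antipodel counitM -scalerAl mul1r scalerA.
  rewrite -[RHS](@sw_counitl _ _ _ (fun x => antipode y * antipode x));
    last by lin_auto.
  apply: eq_tsum => x1 x2.
  rewrite -(lin_tsum _ _ (lin_scaler _ (@lin_id _ _))); congr (_ *: _).
  by rewrite (@sw_counitl _ _ _ (fun y => antipode y * antipode x2)) //; lin_auto.
have -> : sw2 x y (fun x1 y1 x2 y2 => sw2 x2 y2 (fun p1 q1 p2 q2 =>
    F x1 y1 p1 q1 p2 q2)) = antipode (x * y); last by [].
transitivity (sw2 x y (fun x1 y1 x2 y2 =>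
    counit x2 *: (counit y2 *: antipode (x1 * y1)))).
  apply: eq_sw2 => x1 y1 x2 y2.
  transitivity (antipode (x1 * y1) * (\tsum_(p1, p2 <- comul x2)
    p1 * (\tsum_(q1, q2 <- comul y2) q1 * antipode q2) * antipode p2)).
    have l' : lin (fun z => antipode (x1 * y1) * z) by lin_auto.
    rewrite (lin_tsum _ _ l'); apply: eq_tsum => p1 p2.
    have l : lin (fun z => antipode (x1 * y1) * (p1 * z * antipode p2)).
      by lin_auto.
    by rewrite (lin_tsum _ _ l); apply: eq_tsum => *; rewrite /F !mulrA.
  rewrite antipoder.
  under eq_tsum => p1 p2 do rewrite -scalerAr mulr1 -scalerAl.
  rewrite -(lin_tsum _ _ (lin_scaler _ (@lin_id _ _))) antipoder.
  by rewrite -!scalerAr mulr1 scalerA mulrC -scalerA.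
rewrite -[RHS](@sw_counitr _ _ _ (fun x => antipode (x * y))); last by lin_auto.
apply: eq_tsum => x1 x2.
rewrite -(lin_tsum _ _ (lin_scaler _ (@lin_id _ _))); congr (_ *: _).
by rewrite (@sw_counitr _ _ _ (fun y => antipode (x1 * y))) //; lin_auto.
Qed.

End Antipode.

Section BicrossedAntipode.
Context {K : fieldType} {A H : hopfAlgType K} (M : matched_pair A H).

Lemma bicrossed_antipode_l (a : A) :
  antipode (a ⊗ 1 : bicrossed M) = antipode a ⊗ 1.
Proof. by rewrite bicrossed_antipodeE antipode1; exact: bic_mul1. Qed.

Lemma bicrossed_antipode_r (x : H) :
  antipode (1 ⊗ x : bicrossed M) = 1 ⊗ antipode x.
Proof. by rewrite bicrossed_antipodeE antipode1; exact: bic_mulr1. Qed.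

Lemma bicrossed_antipode_sq (a : A) (x : H) :
  antipode (antipode (a ⊗ x : bicrossed M)) =
  antipode (antipode a) ⊗ antipode (antipode x).
Proof.
rewrite bicrossed_antipodeE antipodeM bicrossed_antipode_l bicrossed_antipode_r.
exact: bic_mul_split.
Qed.

End BicrossedAntipode.

(** * Tensor products of automorphisms *)

Section HopfAut.
Context {K : fieldType} {L : hopfAlgType K} {s : L -> L}.
Context (hs : hopf_automorphism s).

Lemma hopf_aut_lin : lin s.
Proof. exact: hopf_aut_linear hs. Qed.

Lemma sw_hopf_aut (U : lmodType K) (F : L -> L -> U) x : bilin F ->
  tsum (comul (s x)) F = \tsum_(x1, x2 <- comul x) F (s x1) (s x2).
Proof.
move=> bF; rewrite (hopf_aut_comul hs) tsum_tsum //.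
by apply: eq_tsum => *; exact: tsum_tens.
Qed.

Lemma hopf_aut_inv : exists2 g, lin g & cancel s g /\ cancel g s.
Proof.
have [g sK gK] := hopf_aut_bij hs; exists g => // c x y.
by apply: (can_inj sK); rewrite hopf_aut_lin !gK.
Qed.

End HopfAut.

Section TensorMap.
Context {K : fieldType} {V W : lmodType K}.

Definition tens_map (f : V -> V) (g : W -> W) (t : (V ⊗ W)%type) :
  (V ⊗ W)%type := \tsum_(v, w <- t) f v ⊗ g w.

Context {f : V -> V} {g : W -> W} (lf : lin f) (lg : lin g).

Let tens_map_bilin : bilin (fun v w => f v ⊗ g w).
Proof.
by split=> ?; [exact: lin_comp (lin_tensl _) lf | exact: lin_comp (lin_tensr _) lg].
Qed.

Lemma lin_tens_map : lin (tens_map f g).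
Proof. exact: lin_tsuml. Qed.

Lemma tens_mapE v w : tens_map f g (v ⊗ w) = f v ⊗ g w.
Proof. exact: tsum_tens. Qed.

End TensorMap.

Lemma tens_mapK {K : fieldType} {V W : lmodType K} (f f' : V -> V)
    (g g' : W -> W) : lin f -> lin g -> lin f' -> lin g' ->
  cancel f f' -> cancel g g' -> cancel (tens_map f g) (tens_map f' g').
Proof.
move=> lf lg lf' lg' fK gK.
apply: (tens_ext (f := fun t => tens_map f' g' (tens_map f g t)) (g := id)).
- exact: lin_comp (lin_tens_map lf' lg') (lin_tens_map lf lg).
- exact: lin_id.
by move=> v w; rewrite !tens_mapE // fK gK.
Qed.

(** * The companion automorphism of the bicrossed product *)

Section BicrossedCompanion.
Context {K : fieldType} {A H : hopfAlgType K} (M : matched_pair A H).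
Context {sA : A -> A} {sH : H -> H}.
Context (autA : hopf_automorphism sA) (autH : hopf_automorphism sH).
Context (sA_lact : forall (x : H) (a : A),
  sA (lact M (x ⊗ a)) = lact M (sH x ⊗ sA a)).
Context (sH_ract : forall (x : H) (a : A),
  sH (ract M (x ⊗ a)) = ract M (sH x ⊗ sA a)).

Definition bic_map : bicrossed M -> bicrossed M := tens_map sA sH.

Let lA : lin sA := hopf_aut_lin autA.
Let lH : lin sH := hopf_aut_lin autH.

Lemma lin_bic_map : lin bic_map.
Proof. exact: lin_tens_map. Qed.

Lemma bic_mapE a x : bic_map (a ⊗ x) = sA a ⊗ sH x.
Proof. exact: tens_mapE. Qed.

Lemma bic_map_bij : bijective bic_map.
Proof.
have [gA lgA [sAK gAK]] := hopf_aut_inv autA.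
have [gH lgH [sHK gHK]] := hopf_aut_inv autH.
by exists (tens_map gA gH); exact: tens_mapK.
Qed.

Lemma bic_map1 : bic_map 1 = 1.
Proof.
by rewrite bicrossed_oneE bic_mapE (hopf_aut_monoid autA).1
  (hopf_aut_monoid autH).1.
Qed.

Lemma bic_map_mul_tens (a b : A) (x y : H) :
  bic_map ((a ⊗ x : bicrossed M) * (b ⊗ y : bicrossed M)) =
  bic_map (a ⊗ x) * bic_map (b ⊗ y).
Proof.
rewrite !bic_mapE !bicrossed_mulE (sw_hopf_aut autH); last by lin_auto.
rewrite (lin_tsum _ _ lin_bic_map); apply: eq_tsum => x1 x2.
rewrite (sw_hopf_aut autA); last by lin_auto.
rewrite (lin_tsum _ _ lin_bic_map); apply: eq_tsum => b1 b2.
by rewrite bic_mapE (hopf_aut_monoid autA).2 (hopf_aut_monoid autH).2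
  sA_lact sH_ract.
Qed.

Lemma bic_map_mul : {morph bic_map : u v / u * v}.
Proof.
move=> u v.
apply: (tens_ext (f := fun u => bic_map ((u : bicrossed M) * v))
  (g := fun u => bic_map u * bic_map v)) => [||a x] {u}.
- exact: lin_comp lin_bic_map (lin_mull _ (@lin_id _ _)).
- exact: lin_mull lin_bic_map.
apply: (tens_ext (f := fun v => bic_map ((a ⊗ x : bicrossed M) * v))
  (g := fun v => bic_map (a ⊗ x) * bic_map v)) => [||b y] {v}.
- exact: lin_comp lin_bic_map (lin_mulr _ (@lin_id _ _)).
- exact: lin_mulr lin_bic_map.
exact: bic_map_mul_tens.
Qed.

Lemma bic_map_comul u :
  comul (bic_map u) = \tsum_(u1, u2 <- comul u) bic_map u1 ⊗ bic_map u2.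
Proof.
have bF : bilin (fun u1 u2 => bic_map u1 ⊗ bic_map u2).
  by split=> w; [exact: lin_comp (lin_tensl _) lin_bic_map
                | exact: lin_comp (lin_tensr _) lin_bic_map].
apply: (tens_ext (f := fun u => comul (bic_map u))
  (g := fun u => tsum (comul (u : bicrossed M))
    (fun u1 u2 => bic_map u1 ⊗ bic_map u2))) => [||a x] {u}.
- exact: lin_comp (linP comul) lin_bic_map.
- exact: lin_comp (lin_tsuml bF) (linP comul).
rewrite bic_mapE !bicrossed_comulE (sw_hopf_aut autA); last by lin_auto.
rewrite (lin_tsum _ _ (lin_tsuml bF)); apply: eq_tsum => a1 a2.
rewrite (sw_hopf_aut autH); last by lin_auto.
rewrite (lin_tsum _ _ (lin_tsuml bF)); apply: eq_tsum => x1 x2.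
by rewrite tsum_tens // !bic_mapE.
Qed.

Lemma bic_map_counit u : counit (bic_map u) = counit u.
Proof.
have lc : lin (counit : bicrossed M -> K^o) by exact: counit_is_linear.
apply: (tens_ext (U := K^o) (f := fun u => counit (bic_map u))
  (g := fun u => counit (u : bicrossed M))) => [||a x] {u}.
- exact: lin_comp lc lin_bic_map.
- exact: lc.
by rewrite bic_mapE !bicrossed_counitE (hopf_aut_counit autA)
  (hopf_aut_counit autH).
Qed.

Lemma bic_map_antipode u : bic_map (antipode u) = antipode (bic_map u).
Proof.
apply: (tens_ext (f := fun u => bic_map (antipode (u : bicrossed M)))
  (g := fun u => antipode (bic_map u))) => [||a x] {u}.
- exact: lin_comp lin_bic_map (linP antipode).
- exact: lin_comp (linP antipode) lin_bic_map.
rewrite bic_mapE !bicrossed_antipodeE bic_map_mul !bic_mapE.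
by rewrite (hopf_aut_monoid autA).1 (hopf_aut_monoid autH).1
  (hopf_aut_antipode autA) (hopf_aut_antipode autH).
Qed.

Lemma bic_map_hopf_automorphism : hopf_automorphism bic_map.
Proof.
split; [exact: bic_map_bij | exact: lin_bic_map | | exact: bic_map_comul
  | exact: bic_map_counit | exact: bic_map_antipode].
by split; [exact: bic_map1 | exact: bic_map_mul].
Qed.

Lemma bic_map_sq : (forall a, sA (sA a) = antipode (antipode a)) ->
  (forall x, sH (sH x) = antipode (antipode x)) ->
  forall u, bic_map (bic_map u) = antipode (antipode u).
Proof.
move=> sqA sqH.
apply: (tens_ext (f := fun u => bic_map (bic_map u))
  (g := fun u => antipode (antipode (u : bicrossed M)))) => [||a x].
- exact: lin_comp lin_bic_map lin_bic_map.
- by move=> c y z; rewrite !linearP.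
by rewrite !bic_mapE sqA sqH bicrossed_antipode_sq.
Qed.

End BicrossedCompanion.

Theorem mainTheorem4 (K : closedFieldType) (charK : [pchar K] =i pred0)
    (A H : hopfAlgType K) (M : matched_pair A H)
    (sA : A -> A) (sH : H -> H)
    (compA : companion sA) (compH : companion sH)
    (sA_lact : forall (x : H) (a : A),
      sA (lact M (x ⊗ a)) = lact M (sH x ⊗ sA a))
    (sH_ract : forall (x : H) (a : A),
      sH (ract M (x ⊗ a)) = ract M (sH x ⊗ sA a)) :
  almost_involutive (bicrossed M).
Proof.
have [autA sqA] := compA; have [autH sqH] := compH.
exists (bic_map M (sA := sA) (sH := sH)); split.
  exact: bic_map_hopf_automorphism.
exact: bic_map_sq.
Qed.
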